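(* Let $K$ be a field equipped with a surjective valuation $\nu:K\to\mathbb{T}$ with valuation ring $\mathcal{O}_K$, let $(A,\phi)$ be a labelled $K$-algebra with $\phi:K[M]\to A$, and let $S$ be a $\mathbb{T}$-algebra. Let $\mathrm{Trop}(A)$ be the coordinate semiring of the scheme-theoretic tropicalization of $\operatorname{Spec} A$ with respect to $\phi$. Then there is a natural one-to-one correspondence $$\{\text{homomorphisms of }\mathbb{T}\text{-algebras } \mathrm{Trop}(A)\to S\}\longleftrightarrow\{\text{monomial valuations on } A \text{ with values in } S\}.$$ Furthermore, $\mathrm{Trop}(A)\simeq\mathbb{S}_{\mathrm{fgmon}}(A)$ as $\mathbb{T}$-algebras.
   Context: $\mathbb{T}=\mathbb{R}\cup\{-\infty\}$ is the tropical semifield with addition $\max$ and multiplication the usual addition of reals ($-\infty$ is the zero element). The valuation $\nu$ is multiplicative, $\nu(x)=-\infty$ iff $x=0$, $\nu(x+y)\le\max(\nu(x),\nu(y))$, and $\mathcal{O}_K=\{x\in K:\nu(x)\le \nu(1)\}$. A $\mathbb{T}$-algebra is a (commutative) semiring $S$ with a semiring homomorphism $\mathbb{T}\to S$; it is additively idempotent and carries the partial order $a\le b\iff a+b=b$. A monoid is a commutative multiplicative monoid with identity and absorbing element $0_M$; $K[M]$ and $\mathbb{T}[M]$ are the monoid (semi)algebras in which $0_M$ is identified with $0$. A labelled $K$-algebra $(A,\phi)$ is a $K$-algebra $A$ with an epimorphism (surjective $K$-algebra homomorphism) $\phi:K[M]\to A$ for some monoid $M$ such that the induced map $M\to A$ is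 injective. A monomial of $A$ is an element $\phi(km)$ with $k\in K$, $m\in M$; $\mathbf{Mon}(A)$ is the multiplicative monoid of monomials. $\mathrm{Trop}(A)$: for $f=\sum_m c_m m\in K[M]$, put $\mathrm{trop}(f)=\sum_m\nu(c_m)m\in\mathbb{T}[M]$. The bend relations of $g\in\mathbb{T}[M]$ are the relations $g\sim g_{\hat m}$, for $m$ in the support of $g$, where $g_{\hat m}$ is $g$ with its $m$-term removed. $\mathrm{Trop}(A)$ is the quotient of $\mathbb{T}[M]$ by the congruence generated by the bend relations of all $\mathrm{trop}(f)$, $f\in\ker\phi$. A monomial valuation on $A$ with values in $S$ is a monoid homomorphism $w:\mathbf{Mon}(A)\to S$ (to the multiplicative monoid of $S$) such that (1) $w(k)=\nu(k)$ for all $k\in K$ (the right side viewed in $S$), and (2) if $x_1,\dots,x_n,y\in\mathbf{Mon}(A)$ and $y$ is an $\mathcal{O}_K$-linear combination of $x_1,\dots,x_n$, then $w(y)\le w(x_1)+\cdots+w(x_n)$. $\mathbb{S}_{\mathrm{fgmon}}(A)$ is the set of $\mathcal{O}_K$-submodules of $A$ generated by finitely many monomials. It is a semiring under $N+N'$ = submodule generated by $N\cup N'$ and $NN'$ = submodule generated by $\{xy: x\in N,y\in N'\}$. It is a $\mathbb{T}$-algebra via $\nu(k)\mapsto\langle k\rangle$, the $\mathcal{O}_K$-submodule generated by $k\in K$. *)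

(* Defs.v *)
From HB Require Import structures.
From mathcomp Require Import all_boot all_order all_algebra.
From mathcomp Require Import finmap.
From mathcomp Require Import boolp classical_sets functions cardinality reals.

Set Implicit Arguments.
Unset Strict Implicit.
Unset Printing Implicit Defensive.

Import Order.TTheory GRing.Theory Num.Theory.

Local Open Scope classical_set_scope.
Local Open Scope ring_scope.

(* The order of an additively idempotent monoid. *)
Definition idem_le (S : nmodType) (a b : S) : Prop := a + b = b.
Notation "a <=+ b" := (idem_le a b) (at level 70, no associativity).

(* [None] is -oo; the ring operations [+] and [*] of [tropical R] are [max]
   and the addition of [R], so that [0 = None] and [1 = Some 0]. *)
Definition tropical (R : realType) : Type := option R.

Section Tropical.
Variable R : realType.

HB.instance Definition _ := Choice.copy (tropical R) (option R).

Definition trop_add (x y : tropical R) : tropical R :=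
  match x, y with
  | None, _ => y
  | _, None => x
  | Some a, Some b => Some (Num.max a b)
  end.

Definition trop_mul (x y : tropical R) : tropical R :=
  if x is Some a then if y is Some b then Some (a + b) else None else None.

Fact trop_addA : associative trop_add.
Proof. by move=> [a|] [b|] [c|] //=; rewrite maxA. Qed.
Fact trop_addC : commutative trop_add.
Proof. by move=> [a|] [b|] //=; rewrite maxC. Qed.
Fact trop_add0 : left_id None trop_add.
Proof. by case. Qed.

HB.instance Definition _ :=
  GRing.isNmodule.Build (tropical R) trop_addA trop_addC trop_add0.

Fact trop_mulA : associative trop_mul.
Proof. by move=> [a|] [b|] [c|] //=; rewrite addrA. Qed.
Fact trop_mulC : commutative trop_mul.
Proof. by move=> [a|] [b|] //=; rewrite addrC. Qed.
Fact trop_mul1 : left_id (Some 0) trop_mul.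
Proof. by case=> [a|] //=; rewrite add0r. Qed.
Fact trop_mulDl : left_distributive trop_mul +%R.
Proof. by move=> [a|] [b|] [c|] //=; rewrite addr_maxl. Qed.
Fact trop_mul0 : left_zero 0 trop_mul.
Proof. by []. Qed.

HB.instance Definition _ := GRing.Nmodule_isComPzSemiRing.Build (tropical R)
  trop_mulA trop_mulC trop_mul1 trop_mulDl trop_mul0.

Lemma trop_le_total (x y : tropical R) : x <=+ y \/ y <=+ x.
Proof.
case: x y => [a|] [b|]; rewrite /idem_le; [|by right|by left|by left].
have [ab|/ltW ba] := leP a b; [left|right]; congr Some; exact: max_r.
Qed.

End Tropical.

Record valuation (K : fieldType) (R : realType) := Valuation {
  val_fun :> K -> tropical R;
  valM : {morph val_fun : x y / x * y};
  val_eq0 : forall x, val_fun x = 0 <-> x = 0;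
  valD : forall x y, val_fun (x + y) <=+ val_fun x + val_fun y }.

Definition valuation_ring (K : fieldType) (R : realType) (nu : valuation K R)
  : set K := [set c | nu c <=+ nu 1].

(* Neither [comSemiAlgType] nor [comAlgType] allows the zero ring, whence the
   explicit structure morphisms below. *)
Record algebra (R : comPzSemiRingType) := Algebra {
  alg_sort :> comPzSemiRingType;
  alg_map : {rmorphism R -> alg_sort} }.

Definition alg_hom (R : comPzSemiRingType) (S S' : algebra R) (f : S -> S')
  : Prop :=
  [/\ nmod_morphism f, monoid_morphism f
    & forall t, f (alg_map S t) = alg_map S' t].

HB.mixin Record Monoid_isComMonoid0 M of Monoid M := {
  zerom : M;
  mulmC : forall x y : M, (x * y = y * x)%g;
  mul0m : forall x : M, (zerom * x = zerom)%g
}.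

#[short(type="comMonoid0Type")]
HB.structure Definition ComMonoid0 := {M of Monoid_isComMonoid0 M & Monoid M}.

(* The quotient of the usual monoid algebra by the line spanned by the
   absorbing element: finitely supported functions vanishing at [zerom]. *)
Record monalg (R : comPzSemiRingType) (M : comMonoid0Type) := MonAlg {
  coefm :> {fsfun M -> R with 0};
  coefm0 : coefm zerom == 0 }.

Section MonAlgChoice.
Variables (R : comPzSemiRingType) (M : comMonoid0Type).
HB.instance Definition _ := [isSub for @coefm R M].
HB.instance Definition _ := [Choice of monalg R M by <:].
End MonAlgChoice.

Definition suppm (R : comPzSemiRingType) (M : comMonoid0Type) (f : monalg R M)
  : {fset M} := finsupp f.

Section MonAlg.
Variables (R : comPzSemiRingType) (M : comMonoid0Type).
Implicit Types (f g h : monalg R M) (m : M) (c : R).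

Lemma monalgP f g : (forall m, f m = g m) <-> f = g.
Proof. by split=> [fg|->//]; apply/val_inj/fsfunP. Qed.

Lemma coefm_zerom f : f zerom = 0.
Proof. exact/eqP/coefm0. Qed.

Lemma in_suppm f m : (m \in suppm f) = (f m != 0).
Proof. by rewrite mem_finsupp. Qed.

Definition monalg_zero_fun : {fsfun M -> R with 0} := [fsfun].
Fact monalg_zero_subproof : monalg_zero_fun zerom == 0.
Proof. by rewrite fsfunE. Qed.
Definition monalg_zero : monalg R M := MonAlg monalg_zero_subproof.

Definition monalg_add_fun f g : {fsfun M -> R with 0} :=
  [fsfun m in (suppm f `|` suppm g)%fset => f m + g m].
Lemma monalg_add_funE f g m : monalg_add_fun f g m = f m + g m.
Proof.
rewrite fsfunE inE !in_suppm; case: ifPn => //.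
by rewrite negb_or !negbK => /andP[/eqP-> /eqP->]; rewrite addr0.
Qed.
Fact monalg_add_subproof f g : monalg_add_fun f g zerom == 0.
Proof. by rewrite monalg_add_funE !coefm_zerom addr0. Qed.
Definition monalg_add f g : monalg R M := MonAlg (monalg_add_subproof f g).

Fact monalg_addA : associative monalg_add.
Proof. by move=> f g h; apply/monalgP => m; rewrite !monalg_add_funE addrA. Qed.
Fact monalg_addC : commutative monalg_add.
Proof. by move=> f g; apply/monalgP => m; rewrite !monalg_add_funE addrC. Qed.
Fact monalg_add0 : left_id monalg_zero monalg_add.
Proof.
by move=> f; apply/monalgP => m; rewrite monalg_add_funE fsfunE add0r.
Qed.

HB.instance Definition _ :=
  GRing.isNmodule.Build (monalg R M) monalg_addA monalg_addC monalg_add0.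

Lemma coefmD f g m : (f + g) m = f m + g m.
Proof. exact: monalg_add_funE. Qed.
Lemma coefm_eq0 m : (0 : monalg R M) m = 0.
Proof. by rewrite fsfunE. Qed.

Definition monom_fun c m : {fsfun M -> R with 0} :=
  [fsfun m' in [fset m]%fset => if m' == zerom then 0 else c].
Fact monom_subproof c m : monom_fun c m zerom == 0.
Proof. by rewrite fsfunE inE eqxx; case: ifP. Qed.
Definition monom c m : monalg R M := MonAlg (monom_subproof c m).

Lemma coef_monom c m m' :
  monom c m m' = if (m' == m) && (m' != zerom) then c else 0.
Proof. by rewrite fsfunE inE; case: (m' == m); case: (m' == zerom). Qed.

Lemma monom_zerom c : monom c zerom = 0.
Proof.
by apply/monalgP => m; rewrite coef_monom coefm_eq0 andbN.
Qed.
Lemma monom0 m : monom 0 m = 0.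
Proof. by apply/monalgP => m'; rewrite coef_monom coefm_eq0; case: ifP. Qed.
Lemma monomD c d m : monom (c + d) m = monom c m + monom d m.
Proof.
by apply/monalgP => m'; rewrite coefmD !coef_monom; case: ifP; rewrite ?addr0.
Qed.

Lemma coefm_sum (I : Type) (r : seq I) (P : pred I) (F : I -> monalg R M) m :
  (\sum_(i <- r | P i) F i) m = \sum_(i <- r | P i) F i m.
Proof.
by apply: (big_morph (fun f : monalg R M => f m));
  [move=> f g; rewrite coefmD | rewrite coefm_eq0].
Qed.

Lemma monalgE f : f = \sum_(m <- suppm f) monom (f m) m.
Proof.
apply/monalgP => m; rewrite coefm_sum.
have [fm|] := boolP (m \in suppm f); last first.
  rewrite in_suppm negbK => /eqP fm0; rewrite big_seq big1 // => m' m'f.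
  rewrite coef_monom; case: eqP => //= mm'.
  by move: m'f; rewrite -mm' in_suppm fm0 eqxx.
rewrite (big_fsetD1 m) //= coef_monom eqxx /= big_seq big1 => [|m'].
  rewrite addr0; case: eqP => //= ->; exact: coefm_zerom.
by rewrite !inE coef_monom eq_sym; case: eqP.
Qed.

Lemma monalg_ind (P : monalg R M -> Prop) :
  P 0 -> (forall f g, P f -> P g -> P (f + g)) ->
  (forall c m, P (monom c m)) -> forall f, P f.
Proof.
move=> P0 PD Pm f; rewrite (monalgE f).
by apply: (big_ind P) => // m _.
Qed.

Section Lin.
Variables (V : nmodType) (F : M -> R -> V).
Hypothesis F_add : forall m, nmod_morphism (F m).
Hypothesis F_zerom : forall c, F zerom c = 0.

Definition linm f : V := \sum_(m <- suppm f) F m (f m).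

Lemma linm_sup f (X : {fset M}) :
  (suppm f `<=` X)%fset -> linm f = \sum_(m <- X) F m (f m).
Proof.
move=> fX; apply: big_fset_incl => // m _.
by rewrite in_suppm negbK => /eqP ->; case: (F_add m).
Qed.

Lemma linm0 : linm 0 = 0.
Proof.
rewrite /linm big_seq big1 // => m.
by rewrite in_suppm coefm_eq0 eqxx.
Qed.

Lemma linmD f g : linm (f + g) = linm f + linm g.
Proof.
pose X := (suppm f `|` suppm g)%fset.
rewrite (@linm_sup f X) ?fsubsetUl // (@linm_sup g X) ?fsubsetUr //.
rewrite (@linm_sup (f + g) X) => [|].
  by rewrite -big_split; apply: eq_bigr => m _; rewrite coefmD (F_add m).2.
apply/fsubsetP => m; rewrite inE !in_suppm coefmD.
by apply: contraR; rewrite negb_or !negbK => /andP[/eqP-> /eqP->]; rewrite addr0.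
Qed.

Lemma linm_monom c m : linm (monom c m) = F m c.
Proof.
have [->|m0] := eqVneq m zerom; first by rewrite monom_zerom F_zerom linm0.
rewrite (@linm_sup _ [fset m]%fset) ?big_seq_fset1 ?coef_monom ?eqxx ?m0 //.
apply/fsubsetP => m'; rewrite inE in_suppm coef_monom.
by case: (m' == m) => //=; rewrite eqxx.
Qed.
End Lin.

Definition monalg_mul f g : monalg R M :=
  \sum_(a <- suppm f) \sum_(b <- suppm g) monom (f a * g b) (a * b)%g.

Definition monalg_one : monalg R M := monom 1 1%g.

Fact monalg_mul_inner a c :
  let F b d := monom (c * d) (a * b)%g in
  (forall b, nmod_morphism (F b)) /\ (forall d, F zerom d = 0).
Proof.
split=> [b|d] /=; last by rewrite mulmC mul0m monom_zerom.
by split=> [|x y] /=; rewrite ?mulr0 ?monom0 // mulrDr monomD.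
Qed.

Lemma monalg_mulE f g :
  monalg_mul f g = linm (fun a c => linm (fun b d => monom (c * d) (a * b)%g) g) f.
Proof. by []. Qed.

Fact monalg_mul_outer g :
  let F a c := linm (fun b d => monom (c * d) (a * b)%g) g in
  (forall a, nmod_morphism (F a)) /\ (forall c, F zerom c = 0).
Proof.
split=> [a|c] /=; last first.
  by rewrite /linm big1 // => b _; rewrite mul0m monom_zerom.
split=> [|x y] /=; first by rewrite /linm big1 // => b _; rewrite mul0r monom0.
by rewrite /linm -big_split; apply: eq_bigr => b _; rewrite mulrDl monomD.
Qed.

Lemma monalg_mulDl : left_distributive monalg_mul +%R.
Proof.
move=> f g h; rewrite !monalg_mulE.
by rewrite linmD //; case: (monalg_mul_outer h).
Qed.
Lemma monalg_mul0l : left_zero 0 monalg_mul.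
Proof. by move=> f; rewrite monalg_mulE linm0. Qed.
Lemma monalg_mul_monom c d a b :
  monalg_mul (monom c a) (monom d b) = monom (c * d) (a * b)%g.
Proof.
rewrite monalg_mulE; have [H0 H1] := monalg_mul_outer (monom d b).
rewrite linm_monom //; have [K0 K1] := monalg_mul_inner a c.
by rewrite linm_monom.
Qed.

Lemma monalg_mulC : commutative monalg_mul.
Proof.
move=> f g; rewrite /monalg_mul exchange_big /=.
by apply: eq_bigr => a _; apply: eq_bigr => b _; rewrite mulrC mulmC.
Qed.
Lemma monalg_mulDr : right_distributive monalg_mul +%R.
Proof.
by move=> f g h; rewrite monalg_mulC monalg_mulDl !(monalg_mulC _ f).
Qed.
Lemma monalg_mul0r : right_zero 0 monalg_mul.
Proof. by move=> f; rewrite monalg_mulC monalg_mul0l. Qed.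

Lemma monalg_mulA : associative monalg_mul.
Proof.
move=> f g h.
elim/monalg_ind: f => [|f1 f2 IH1 IH2|c a].
- by rewrite !monalg_mul0l.
- by rewrite !monalg_mulDl IH1 IH2.
elim/monalg_ind: g => [|g1 g2 IH1 IH2|d b].
- by rewrite !(monalg_mul0l, monalg_mul0r).
- by rewrite monalg_mulDl !monalg_mulDr monalg_mulDl IH1 IH2.
elim/monalg_ind: h => [|h1 h2 IH1 IH2|e x].
- by rewrite !monalg_mul0r.
- by rewrite !monalg_mulDr IH1 IH2.
by rewrite !monalg_mul_monom mulrA mulgA.
Qed.

Lemma monalg_mul1 : left_id monalg_one monalg_mul.
Proof.
move=> f; elim/monalg_ind: f => [|f1 f2 IH1 IH2|c m].
- by rewrite monalg_mul0r.
- by rewrite monalg_mulDr IH1 IH2.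
by rewrite /monalg_one monalg_mul_monom mul1r mul1g.
Qed.

HB.instance Definition _ := GRing.Nmodule_isComPzSemiRing.Build (monalg R M)
  monalg_mulA monalg_mulC monalg_mul1 monalg_mulDl monalg_mul0l.

Lemma monomM c d a b : monom c a * monom d b = monom (c * d) (a * b)%g.
Proof. exact: monalg_mul_monom. Qed.

Definition monalgC c : monalg R M := monom c 1%g.

Fact monalgC_is_nmod_morphism : nmod_morphism monalgC.
Proof. by split=> [|c d]; rewrite /monalgC ?monom0 ?monomD. Qed.
Fact monalgC_is_monoid_morphism : monoid_morphism monalgC.
Proof. by split=> // c d; rewrite /monalgC monomM mul1g. Qed.
HB.instance Definition _ :=
  GRing.isNmodMorphism.Build R (monalg R M) monalgC monalgC_is_nmod_morphism.
HB.instance Definition _ :=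
  GRing.isMonoidMorphism.Build R (monalg R M) monalgC
    monalgC_is_monoid_morphism.

End MonAlg.

Section Congruence.
Variable S : comPzSemiRingType.

Record is_congruence (C : S -> S -> Prop) : Prop := IsCongruence {
  congr_refl : forall a, C a a;
  congr_sym : forall a b, C a b -> C b a;
  congr_trans : forall a b c, C a b -> C b c -> C a c;
  congrD : forall a b c d, C a b -> C c d -> C (a + c) (b + d);
  congrM : forall a b c d, C a b -> C c d -> C (a * c) (b * d) }.

Variable r : S -> S -> Prop.

Definition gen_congr (a b : S) : Prop :=
  forall C, is_congruence C -> (forall u v, r u v -> C u v) -> C a b.

Lemma gen_congr_sub a b : r a b -> gen_congr a b.
Proof. by move=> rab C _; exact. Qed.

Lemma gen_congrP : is_congruence gen_congr.
Proof.
split=> [a|a b ab|a b c ab bc|a b c d ab cd|a b c d ab cd] C CC rC.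
- exact: congr_refl.
- by apply: (congr_sym CC); exact: ab.
- exact: (congr_trans CC (ab _ CC rC) (bc _ CC rC)).
- exact: (congrD CC (ab _ CC rC) (cd _ CC rC)).
- exact: (congrM CC (ab _ CC rC) (cd _ CC rC)).
Qed.

Definition gen_congrb (a b : S) : bool := `[< gen_congr a b >].

Fact gen_congrb_refl : reflexive gen_congrb.
Proof. by move=> a; apply/asboolP; exact: (congr_refl gen_congrP). Qed.
Fact gen_congrb_sym : symmetric gen_congrb.
Proof.
by move=> a b; apply/asboolP/asboolP; exact: (congr_sym gen_congrP).
Qed.
Fact gen_congrb_trans : transitive gen_congrb.
Proof.
by move=> b a c /asboolP ab /asboolP bc; apply/asboolP;
  exact: (congr_trans gen_congrP ab bc).
Qed.
Canonical gen_congr_equiv :=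
  EquivRel gen_congrb gen_congrb_refl gen_congrb_sym gen_congrb_trans.

Local Open Scope quotient_scope.

Definition congr_quot : Type := {eq_quot gen_congr_equiv}.
HB.instance Definition _ : EqQuotient S gen_congr_equiv congr_quot :=
  EqQuotient.on congr_quot.
HB.instance Definition _ := Choice.on congr_quot.

Definition congr_pi (a : S) : congr_quot := \pi_congr_quot a.

Lemma congr_piP a b : congr_pi a = congr_pi b <-> gen_congr a b.
Proof.
split=> [/eqP|ab]; first by rewrite /congr_pi piE => /asboolP.
by apply/eqP; rewrite /congr_pi piE; apply/asboolP.
Qed.

Lemma congr_pi_repr (x : congr_quot) : congr_pi (repr x) = x.
Proof. exact: reprK. Qed.

Definition quot_add (x y : congr_quot) := congr_pi (repr x + repr y).
Definition quot_mul (x y : congr_quot) := congr_pi (repr x * repr y).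

Lemma quot_addE a b : quot_add (congr_pi a) (congr_pi b) = congr_pi (a + b).
Proof.
by apply/congr_piP; apply: (congrD gen_congrP); apply/congr_piP; rewrite congr_pi_repr.
Qed.
Lemma quot_mulE a b : quot_mul (congr_pi a) (congr_pi b) = congr_pi (a * b).
Proof.
by apply/congr_piP; apply: (congrM gen_congrP); apply/congr_piP; rewrite congr_pi_repr.
Qed.

Lemma congr_quot_ind (P : congr_quot -> Prop) :
  (forall a, P (congr_pi a)) -> forall x, P x.
Proof. by move=> Ppi x; rewrite -(congr_pi_repr x). Qed.

Fact quot_addA : associative quot_add.
Proof.
elim/congr_quot_ind=> a; elim/congr_quot_ind=> b; elim/congr_quot_ind=> c.
by rewrite !quot_addE addrA.
Qed.
Fact quot_addC : commutative quot_add.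
Proof.
by elim/congr_quot_ind=> a; elim/congr_quot_ind=> b; rewrite !quot_addE addrC.
Qed.
Fact quot_add0 : left_id (congr_pi 0) quot_add.
Proof. by elim/congr_quot_ind=> a; rewrite quot_addE add0r. Qed.

HB.instance Definition _ :=
  GRing.isNmodule.Build congr_quot quot_addA quot_addC quot_add0.

Fact quot_mulA : associative quot_mul.
Proof.
elim/congr_quot_ind=> a; elim/congr_quot_ind=> b; elim/congr_quot_ind=> c.
by rewrite !quot_mulE mulrA.
Qed.
Fact quot_mulC : commutative quot_mul.
Proof.
by elim/congr_quot_ind=> a; elim/congr_quot_ind=> b; rewrite !quot_mulE mulrC.
Qed.
Fact quot_mul1 : left_id (congr_pi 1) quot_mul.
Proof. by elim/congr_quot_ind=> a; rewrite quot_mulE mul1r. Qed.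
Fact quot_mulDl : left_distributive quot_mul quot_add.
Proof.
elim/congr_quot_ind=> a; elim/congr_quot_ind=> b; elim/congr_quot_ind=> c.
by rewrite !(quot_mulE, quot_addE) mulrDl.
Qed.
Fact quot_mul0 : left_zero (congr_pi 0) quot_mul.
Proof. by elim/congr_quot_ind=> a; rewrite quot_mulE mul0r. Qed.

HB.instance Definition _ := GRing.Nmodule_isComPzSemiRing.Build congr_quot
  quot_mulA quot_mulC quot_mul1 quot_mulDl quot_mul0.

Fact congr_pi_is_nmod_morphism : nmod_morphism congr_pi.
Proof. by split=> // a b; rewrite -quot_addE. Qed.
Fact congr_pi_is_monoid_morphism : monoid_morphism congr_pi.
Proof. by split=> // a b; rewrite -quot_mulE. Qed.
HB.instance Definition _ :=
  GRing.isNmodMorphism.Build S congr_quot congr_pi congr_pi_is_nmod_morphism.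
HB.instance Definition _ :=
  GRing.isMonoidMorphism.Build S congr_quot congr_pi
    congr_pi_is_monoid_morphism.

End Congruence.

Record labelled_algebra (K : fieldType) := LabelledAlgebra {
  lab_ring :> comPzRingType;
  lab_scal : {rmorphism K -> lab_ring};
  lab_monoid : comMonoid0Type;
  lab_map : {rmorphism monalg K lab_monoid -> lab_ring};
  lab_mapC : forall c, lab_map (monalgC lab_monoid c) = lab_scal c;
  lab_surj : forall a, exists f, lab_map f = a;
  lab_inj : injective (fun m => lab_map (monom 1 m)) }.

Section Tropicalization.
Variables (K : fieldType) (R : realType) (nu : valuation K R).
Variable A : labelled_algebra K.
Local Notation M := (lab_monoid A).
Local Notation phi := (lab_map A).

Definition trop_poly (f : monalg K M) : monalg (tropical R) M :=
  \sum_(m <- suppm f) monom (nu (f m)) m.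

Definition del_term (g : monalg (tropical R) M) (m : M)
  : monalg (tropical R) M :=
  \sum_(m' <- suppm g | m' != m) monom (g m') m'.

Definition bend (g u v : monalg (tropical R) M) : Prop :=
  exists2 m, m \in suppm g & u = g /\ v = del_term g m.

Definition trop_rel (u v : monalg (tropical R) M) : Prop :=
  exists2 f, phi f = 0 & bend (trop_poly f) u v.

Definition Trop_semiring : Type := congr_quot trop_rel.
HB.instance Definition _ := GRing.ComPzSemiRing.on Trop_semiring.

Definition Trop_proj
  : {rmorphism monalg (tropical R) M -> Trop_semiring} :=
  @congr_pi _ trop_rel.

Definition Trop : algebra (tropical R) :=
  Algebra (Trop_proj \o @monalgC (tropical R) M).

End Tropicalization.

Section Monomials.
Variables (K : fieldType) (A : labelled_algebra K).
Local Notation M := (lab_monoid A).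
Local Notation phi := (lab_map A).

Definition monomials : set A := [set x | exists k m, x = phi (monom k m)].

Lemma monomials_phi k m : monomials (phi (monom k m)).
Proof. by exists k, m. Qed.
Lemma monomials1 : monomials 1.
Proof. by rewrite -(rmorph1 phi); exact: monomials_phi. Qed.
Lemma monomialsM x y : monomials x -> monomials y -> monomials (x * y).
Proof.
move=> [k [m ->]] [l [n ->]]; rewrite -rmorphM monomM.
exact: monomials_phi.
Qed.
Lemma monomials_scal k : monomials (lab_scal A k).
Proof. by rewrite -lab_mapC; exact: monomials_phi. Qed.

Record Mon := MkMon { Mon_val :> A; MonP : `[< monomials Mon_val >] }.
HB.instance Definition _ := [isSub for Mon_val].
HB.instance Definition _ := [Choice of Mon by <:].

Definition to_Mon x (Mx : monomials x) : Mon := MkMon (asboolT Mx).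

Lemma Mon_monomial (x : Mon) : monomials (Mon_val x).
Proof. by case: x => x /= /asboolP. Qed.

Definition Mon_one : Mon := to_Mon monomials1.
Definition Mon_mul (x y : Mon) : Mon :=
  to_Mon (monomialsM (Mon_monomial x) (Mon_monomial y)).

Fact Mon_mulA : associative Mon_mul.
Proof. by move=> x y z; apply: val_inj; rewrite /= mulrA. Qed.
Fact Mon_mul1 : left_id Mon_one Mon_mul.
Proof. by move=> x; apply: val_inj; rewrite /= mul1r. Qed.
Fact Mon_1mul : right_id Mon_one Mon_mul.
Proof. by move=> x; apply: val_inj; rewrite /= mulr1. Qed.
HB.instance Definition _ := isMonoid.Build Mon Mon_mulA Mon_mul1 Mon_1mul.

Definition Mon_of (k : K) (m : M) : Mon := to_Mon (monomials_phi k m).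
Definition Mon_scal (k : K) : Mon := to_Mon (monomials_scal k).

End Monomials.

Section MonomialValuation.
Variables (K : fieldType) (R : realType) (nu : valuation K R).
Variables (A : labelled_algebra K) (S : algebra (tropical R)).

(* The clause [w (Mon_scal A 0) = alg_map S (nu 0)] makes [w] preserve the
   absorbing element. *)
Record monomial_valuation (w : Mon A -> S) : Prop := MonomialValuation {
  mval1 : w 1%g = 1;
  mvalM : forall x y, w (x * y)%g = w x * w y;
  mval_scal : forall k, w (Mon_scal A k) = alg_map S (nu k);
  mval_lin : forall (n : nat) (x : 'I_n -> Mon A) (y : Mon A) (c : 'I_n -> K),
    (forall i, valuation_ring nu (c i)) ->
    Mon_val y = \sum_(i < n) lab_scal A (c i) * Mon_val (x i) ->
    w y <=+ \sum_(i < n) w (x i) }.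

End MonomialValuation.

Section FgMon.
Variables (K : fieldType) (R : realType) (nu : valuation K R).
Variable A : labelled_algebra K.
Implicit Types (N X Y Z : set A).

Record OK_submodule N : Prop := OKSubmodule {
  submod0 : N 0;
  submodD : forall x y, N x -> N y -> N (x + y);
  submodZ : forall c x, valuation_ring nu c -> N x -> N (lab_scal A c * x) }.

Definition OK_span X : set A := smallest OK_submodule X.

Definition mulset X Y : set A := [set x * y | x in X & y in Y].

Definition is_fgmon N : Prop :=
  exists2 X : set A, finite_set X /\ X `<=` @monomials K A & N = OK_span X.

Lemma OK_span_submod X : OK_submodule (OK_span X).
Proof.
split=> [N [N_sub _]|x y Xx Xy N NX|c x Oc Xx N NX].
- exact: submod0.
- by apply: submodD (NX.1) _ _ (Xx _ NX) (Xy _ NX).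
- exact: submodZ (NX.1) _ _ Oc (Xx _ NX).
Qed.

Lemma OK_span_min X N : OK_submodule N -> X `<=` N -> OK_span X `<=` N.
Proof. exact: smallest_sub. Qed.
Lemma OK_span_sub X Y : X `<=` OK_span Y -> OK_span X `<=` OK_span Y.
Proof. by apply: OK_span_min; exact: OK_span_submod. Qed.
Lemma sub_OK_span X : X `<=` OK_span X.
Proof. exact: sub_gen_smallest. Qed.
Lemma OK_span_mono X Y : X `<=` Y -> OK_span X `<=` OK_span Y.
Proof. by move=> XY; apply: OK_span_sub => x /XY; apply: sub_OK_span. Qed.
Lemma OK_span_idem X : OK_span (OK_span X) = OK_span X.
Proof. by apply: smallest_id; exact: OK_span_submod. Qed.

Lemma OK_spanUl X Y : OK_span (OK_span X `|` Y) = OK_span (X `|` Y).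
Proof.
apply/seteqP; split; apply: OK_span_sub.
  move=> x [|Yx]; last by apply: sub_OK_span; right.
  by apply: OK_span_mono => y; left.
by move=> x [Xx|Yx]; apply: sub_OK_span; [left; apply: sub_OK_span|right].
Qed.
Lemma OK_spanUr X Y : OK_span (X `|` OK_span Y) = OK_span (X `|` Y).
Proof. by rewrite setUC OK_spanUl setUC. Qed.

Lemma mulsetC X Y : mulset X Y = mulset Y X.
Proof.
by apply/seteqP; split=> _ [x Xx [y Yy <-]]; exists y => //; exists x => //;
  rewrite mulrC.
Qed.
Lemma mulsetA X Y Z : mulset X (mulset Y Z) = mulset (mulset X Y) Z.
Proof.
apply/seteqP; split.
  move=> _ [x Xx [_ [y Yy [z Zz <-]] <-]].
  by exists (x * y); [exists x => //; exists y|exists z => //; rewrite mulrA].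
move=> _ [_ [x Xx [y Yy <-]] [z Zz <-]].
by exists x => //; exists (y * z); [exists y => //; exists z|rewrite mulrA].
Qed.
Lemma mulsetUl X Y Z : mulset (X `|` Y) Z = mulset X Z `|` mulset Y Z.
Proof.
apply/seteqP; split.
  by move=> _ [x [Xx|Yx] [z Zz <-]]; [left|right]; exists x => //; exists z.
by move=> _ [[x Xx [z Zz <-]]|[x Yx [z Zz <-]]]; exists x; do ?[by left|by right];
  exists z.
Qed.
Lemma mulset1 X : mulset [set 1] X = X.
Proof.
apply/seteqP; split=> [_ [_ -> [x Xx <-]]|x Xx]; first by rewrite mul1r.
by exists 1 => //; exists x => //; rewrite mul1r.
Qed.
Lemma mulset0 X : mulset set0 X = set0.
Proof. by apply/seteqP; split=> // x []. Qed.

Lemma OK_spanMl X Y : OK_span (mulset (OK_span X) Y) = OK_span (mulset X Y).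
Proof.
apply/seteqP; split; last first.
  apply: OK_span_mono => _ [x Xx [y Yy <-]].
  by exists x; [apply: sub_OK_span|exists y].
apply: OK_span_sub => _ [x Xx [y Yy <-]].
pose N := [set a | OK_span (mulset X Y) (a * y)].
suff : OK_span X `<=` N by apply.
apply: OK_span_min => [|a Xa]; last first.
  by apply: sub_OK_span; exists a => //; exists y.
have H := OK_span_submod (mulset X Y).
split=> [|a b Na Nb|c a Oc Na]; rewrite /N /=.
- by rewrite mul0r; exact: submod0 H.
- by rewrite mulrDl; exact: submodD H _ _ Na Nb.
- by rewrite -mulrA; exact: submodZ H _ _ Oc Na.
Qed.
Lemma OK_spanMr X Y : OK_span (mulset X (OK_span Y)) = OK_span (mulset X Y).
Proof. by rewrite mulsetC OK_spanMl mulsetC. Qed.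

Lemma is_fgmon0 : is_fgmon (OK_span set0).
Proof. by exists set0 => //; split=> //; exact: sub0set. Qed.
Lemma is_fgmon_monomial x : @monomials K A x -> is_fgmon (OK_span [set x]).
Proof.
by move=> Mx; exists [set x] => //; split=> [|_ ->//]; exact: finite_set1.
Qed.
Lemma is_fgmonD N N' :
  is_fgmon N -> is_fgmon N' -> is_fgmon (OK_span (N `|` N')).
Proof.
move=> [X [fX MX] ->] [Y [fY MY] ->]; exists (X `|` Y).
  by rewrite finite_setU subUset.
by rewrite OK_spanUl OK_spanUr.
Qed.
Lemma is_fgmonM N N' :
  is_fgmon N -> is_fgmon N' -> is_fgmon (OK_span (mulset N N')).
Proof.
move=> [X [fX MX] ->] [Y [fY MY] ->]; exists (mulset X Y).
  split; first exact: finite_image2.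
  by move=> _ [x Xx [y Yy <-]]; apply: monomialsM; [apply: MX|apply: MY].
by rewrite OK_spanMl OK_spanMr.
Qed.
Lemma is_fgmon_span N : is_fgmon N -> OK_span N = N.
Proof. by move=> [X _ ->]; exact: OK_span_idem. Qed.

Record fgmon := MkFgmon { fgmon_set :> set A; fgmonP : `[< is_fgmon fgmon_set >] }.
HB.instance Definition _ := [isSub for fgmon_set].
HB.instance Definition _ := [Choice of fgmon by <:].

Definition to_fgmon N (fN : is_fgmon N) : fgmon := MkFgmon (asboolT fN).

Lemma fgmon_is (N : fgmon) : is_fgmon N.
Proof. by case: N => N /= /asboolP. Qed.
Lemma fgmonK (N : fgmon) : OK_span N = N.
Proof. by apply: is_fgmon_span; exact: fgmon_is. Qed.

(* The empty set spans the zero submodule. *)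
Definition fgmon_zero : fgmon := to_fgmon is_fgmon0.
Definition fgmon_one : fgmon := to_fgmon (is_fgmon_monomial (monomials1 A)).
Definition fgmon_add (N N' : fgmon) : fgmon :=
  to_fgmon (is_fgmonD (fgmon_is N) (fgmon_is N')).
Definition fgmon_mul (N N' : fgmon) : fgmon :=
  to_fgmon (is_fgmonM (fgmon_is N) (fgmon_is N')).

Fact fgmon_addA : associative fgmon_add.
Proof.
by move=> N N' N''; apply: val_inj; rewrite /= OK_spanUr OK_spanUl setUA.
Qed.
Fact fgmon_addC : commutative fgmon_add.
Proof. by move=> N N'; apply: val_inj; rewrite /= setUC. Qed.
Fact fgmon_add0 : left_id fgmon_zero fgmon_add.
Proof.
by move=> N; apply: val_inj; rewrite /= OK_spanUl set0U fgmonK.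
Qed.
HB.instance Definition _ :=
  GRing.isNmodule.Build fgmon fgmon_addA fgmon_addC fgmon_add0.

Fact fgmon_mulA : associative fgmon_mul.
Proof.
by move=> N N' N''; apply: val_inj; rewrite /= OK_spanMr OK_spanMl mulsetA.
Qed.
Fact fgmon_mulC : commutative fgmon_mul.
Proof. by move=> N N'; apply: val_inj; rewrite /= mulsetC. Qed.
Fact fgmon_mul1 : left_id fgmon_one fgmon_mul.
Proof. by move=> N; apply: val_inj; rewrite /= OK_spanMl mulset1 fgmonK. Qed.
Fact fgmon_mulDl : left_distributive fgmon_mul fgmon_add.
Proof.
move=> N N' N''; apply: val_inj.
by rewrite /= OK_spanMl OK_spanUl OK_spanUr mulsetUl.
Qed.
Fact fgmon_mul0 : left_zero fgmon_zero fgmon_mul.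
Proof. by move=> N; apply: val_inj; rewrite /= OK_spanMl mulset0. Qed.
HB.instance Definition _ := GRing.Nmodule_isComPzSemiRing.Build fgmon
  fgmon_mulA fgmon_mulC fgmon_mul1 fgmon_mulDl fgmon_mul0.

Definition fgmon_scal (k : K) : fgmon :=
  to_fgmon (is_fgmon_monomial (monomials_scal A k)).

Lemma le_fgmon_scal k l :
  nu k <=+ nu l -> OK_span [set lab_scal A k] `<=` OK_span [set lab_scal A l].
Proof.
move=> kl; apply: OK_span_sub => _ ->.
have [l0|l0] := eqVneq l 0.
  suff -> : k = 0 by rewrite rmorph0; exact: (submod0 (OK_span_submod _)).
  move: kl; rewrite l0 /idem_le (proj2 (val_eq0 nu 0) erefl) addr0.
  exact: (proj1 (val_eq0 nu k)).
rewrite -[k](divfK l0) rmorphM; apply: (submodZ (OK_span_submod _)); last exact: sub_OK_span.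
rewrite /valuation_ring /= /idem_le -(divff l0) !valM -mulrDl.
by rewrite kl.
Qed.

Lemma fgmon_scal_eq k l : nu k = nu l -> fgmon_scal k = fgmon_scal l.
Proof.
move=> kl; apply: val_inj; apply/seteqP.
by split; apply: le_fgmon_scal; rewrite /idem_le kl;
  case: (trop_le_total (nu l) (nu l)).
Qed.

Lemma fgmon_scalM k l : fgmon_scal (k * l) = fgmon_scal k * fgmon_scal l.
Proof.
apply: val_inj; rewrite /= OK_spanMl OK_spanMr; congr OK_span.
apply/seteqP; split=> [_ ->|_ [_ -> [_ -> <-]]]; last by rewrite -rmorphM.
by exists (lab_scal A k) => //; exists (lab_scal A l) => //; rewrite -rmorphM.
Qed.

Lemma fgmon_scal0 : fgmon_scal 0 = 0.
Proof.
apply: val_inj; apply/seteqP; split; apply: OK_span_sub => // _ ->.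
by rewrite rmorph0; exact: (submod0 (OK_span_submod _)).
Qed.

Lemma fgmon_scal_le k l :
  nu k <=+ nu l -> fgmon_scal k + fgmon_scal l = fgmon_scal l.
Proof.
move=> kl; apply: val_inj; rewrite /= OK_spanUl OK_spanUr.
apply/seteqP; split; apply: OK_span_sub.
  by move=> _ [->|->]; [apply: (le_fgmon_scal kl)|]; apply: sub_OK_span.
by move=> _ ->; apply: sub_OK_span; right.
Qed.

Hypothesis nu_surj : forall t, exists k, nu k = t.

Definition fgmon_map (t : tropical R) : fgmon :=
  fgmon_scal (projT1 (cid (nu_surj t))).

Lemma fgmon_mapE k : fgmon_map (nu k) = fgmon_scal k.
Proof. by apply: fgmon_scal_eq; case: cid. Qed.

Fact fgmon_map_is_nmod_morphism : nmod_morphism fgmon_map.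
Proof.
split=> [|s t].
  by rewrite -(proj2 (val_eq0 nu 0) erefl) fgmon_mapE fgmon_scal0.
have [k <-] := nu_surj s; have [l <-] := nu_surj t.
rewrite /=; case: (trop_le_total (nu k) (nu l)) => kl.
  by rewrite kl !fgmon_mapE (fgmon_scal_le kl).
by rewrite addrC [RHS]addrC kl !fgmon_mapE (fgmon_scal_le kl).
Qed.
Fact fgmon_map_is_monoid_morphism : monoid_morphism fgmon_map.
Proof.
split=> [|s t].
  suff nu1 : nu 1 = 1.
    by rewrite -nu1 fgmon_mapE; apply: val_inj; rewrite /= rmorph1.
  have := valM nu 1 1; rewrite mulr1; case E: (nu 1) => [a|].
    by case=> /(congr1 (fun x => x - a)); rewrite subrr addrK => <-.
  by move: (proj1 (val_eq0 nu 1) E) => /eqP; rewrite oner_eq0.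
have [k <-] := nu_surj s; have [l <-] := nu_surj t.
by rewrite /= -valM !fgmon_mapE fgmon_scalM.
Qed.
HB.instance Definition _ := GRing.isNmodMorphism.Build (tropical R) fgmon
  fgmon_map fgmon_map_is_nmod_morphism.
HB.instance Definition _ := GRing.isMonoidMorphism.Build (tropical R) fgmon
  fgmon_map fgmon_map_is_monoid_morphism.

Definition Sfgmon : algebra (tropical R) := Algebra fgmon_map.

End FgMon.

(* Main.v *)
(* The key point is that if [phi (k m)] is an O_K-combination of monomials
   [phi (k_i m_i)], then [nu(k) m <= sum_i nu(k_i) m_i] in Trop(A), because of
   the bend relation at [m] of the tropicalization of the corresponding element
   of [ker phi]. Hence [phi (k m) |-> nu(k) m] is a well-defined monomial
   valuation with values in Trop(A). It is universal: a monomial valuation [w]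
   extends linearly to T[M], and condition (2) with coefficients -1 says exactly
   that this extension respects the bend relations. The isomorphism with the
   semiring of finitely generated monomial submodules is the homomorphism
   induced by the monomial valuation [x |-> <x>]; it reflects the order since
   membership of [phi (k m)] in the image of [v] is again an O_K-linear
   dependence as in the key point. *)
Require Import Defs.
From mathcomp Require Import all_boot all_order all_algebra.
From mathcomp Require Import finmap cardinality.
From mathcomp Require Import boolp classical_sets functions reals.

Set Implicit Arguments.
Unset Strict Implicit.
Unset Printing Implicit Defensive.

Import Order.TTheory GRing.Theory Num.Theory.

Local Open Scope classical_set_scope.
Local Open Scope ring_scope.

(** * The order of idempotent monoids and of T-algebras *)

Lemma idem_le_anti (S : nmodType) (a b : S) : a <=+ b -> b <=+ a -> a = b.
Proof. by rewrite /idem_le => ab <-; rewrite addrC. Qed.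

Lemma idem_le_trans (S : nmodType) (b a c : S) : a <=+ b -> b <=+ c -> a <=+ c.
Proof. by rewrite /idem_le => ab <-; rewrite addrA ab. Qed.

Lemma idem_leD (S : nmodType) (a b c d : S) :
  a <=+ b -> c <=+ d -> a + c <=+ b + d.
Proof. by rewrite /idem_le => ab cd; rewrite addrACA ab cd. Qed.

Lemma idem_le_mor (S S' : nmodType) (f : S -> S') (a b : S) :
  nmod_morphism f -> a <=+ b -> f a <=+ f b.
Proof. by move=> [_ fD] ab; rewrite /idem_le -fD ab. Qed.

Section TropicalOrder.
Variables (R : realType).
Implicit Types (a b c t : tropical R).

Lemma trop_idem t : t + t = t.
Proof. by case: (trop_le_total t t). Qed.

Lemma trop_leD2 c a b : a <=+ c -> b <=+ c -> a + b <=+ c.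
Proof. by move=> ac bc; rewrite -(trop_idem c); exact: idem_leD. Qed.

Lemma trop_le_mul c a b : a <=+ b -> c * a <=+ c * b.
Proof. by move=> ab; rewrite /idem_le -mulrDr ab. Qed.

(** Idempotency of 1 in T is carried over by the structure morphism and then multiplied by [x]. *)
Lemma alg_idem (S : algebra (tropical R)) (x : S) : x + x = x.
Proof.
by rewrite -[x]mul1r -(rmorph1 (alg_map S)) -mulrDl -rmorphD trop_idem.
Qed.

End TropicalOrder.

(** * Valuations of signs, sums and integral multiples *)

Section Valuation.
Variables (K : fieldType) (R : realType) (nu : valuation K R).

Lemma valuation0 : nu 0 = 0.
Proof. exact/Defs.val_eq0. Qed.

Lemma valuation1 : nu 1 = 1.
Proof.
have := Defs.valM nu 1 1; rewrite mulr1; case E: (nu 1) => [a|].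
  by case=> /(congr1 (fun x => x - a)); rewrite subrr addrK => <-.
by move/(Defs.val_eq0 nu): E => /eqP; rewrite oner_eq0.
Qed.

(** The square of [nu (-1)] is 1, and the additive group of reals has no 2-torsion. *)
Lemma valuationN1 : nu (-1) = 1.
Proof.
have := Defs.valM nu (-1) (-1); rewrite mulrNN mulr1 valuation1.
case: (nu (-1)) => [a|] // [] /esym /eqP.
by rewrite -mulr2n mulrn_eq0 /= => /eqP ->.
Qed.

Lemma valuationN x : nu (- x) = nu x.
Proof. by rewrite -mulN1r Defs.valM valuationN1 mul1r. Qed.

Lemma valuation_ringN1 : valuation_ring nu (-1).
Proof.
by rewrite /valuation_ring /= valuationN1 valuation1 /idem_le trop_idem.
Qed.

Lemma valuation_sum (I : Type) (r : seq I) (F : I -> K) :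
  nu (\sum_(i <- r) F i) <=+ \sum_(i <- r) nu (F i).
Proof.
elim: r => [|i r IH]; first by rewrite !big_nil valuation0 /idem_le addr0.
rewrite !big_cons; apply: idem_le_trans (Defs.valD _ _ _) _.
by apply: idem_leD => //; rewrite /idem_le trop_idem.
Qed.

Lemma valuation_ring_le c x : valuation_ring nu c -> nu (c * x) <=+ nu x.
Proof.
rewrite /valuation_ring /= valuation1 Defs.valM => Oc.
by rewrite -[X in _ <=+ X]mul1r ![_ * nu x]mulrC; exact: trop_le_mul.
Qed.

End Valuation.

(** * Coefficients in monoid algebras *)

Section MonAlgLemmas.
Variables (R : comPzSemiRingType) (M : comMonoid0Type).
Implicit Types (f g : monalg R M) (m : M).

Lemma monalg_leP f g : f <=+ g <-> forall m, f m <=+ g m.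
Proof.
split=> [fg m|fg]; first by rewrite /idem_le -coefmD fg.
by apply/monalgP => m; rewrite coefmD fg.
Qed.

Lemma coef_sum_monom (r : seq M) (h : M -> R) m : uniq r ->
  (\sum_(m' <- r) monom (h m') m') m
    = if (m \in r) && (m != zerom) then h m else 0.
Proof.
move=> r_uniq; rewrite coefm_sum; case: ifPn => [/andP[mr m0]|].
  rewrite (bigD1_seq m) //= coef_monom eqxx m0 big1 ?addr0 // => m' m'm.
  by rewrite coef_monom eq_sym (negPf m'm).
rewrite negb_and negbK => mr0; rewrite big_seq big1 // => m' m'r.
rewrite coef_monom; case: eqP => //= mm'; case: eqP => //= m0.
by move: mr0; rewrite mm' m'r -mm' => /eqP.
Qed.


Lemma coef_monalgCM c f m : (monalgC M c * f) m = c * f m.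
Proof.
elim/monalg_ind: f => [|f g IHf IHg|d a].
- by rewrite mulr0 coefm_eq0 mulr0.
- by rewrite mulrDr !coefmD IHf IHg mulrDr.
by rewrite monomM mul1g !coef_monom; case: ifP; rewrite ?mulr0.
Qed.

End MonAlgLemmas.

(** * Bend relations and the universal monomial valuation *)

Section Bend.
Variables (K : fieldType) (R : realType) (nu : valuation K R).
Variable A : labelled_algebra K.
Local Notation M := (lab_monoid A).
Local Notation phi := (lab_map A).
Local Notation pi := (Trop_proj nu A).
Implicit Types (f P : monalg K M) (g u v : monalg (tropical R) M) (m : M).

Lemma coef_trop_poly f m : trop_poly nu f m = nu (f m).
Proof.
rewrite /trop_poly coef_sum_monom; last exact: fset_uniq.
case: ifPn => //; rewrite negb_and negbK in_suppm negbK.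
by case/orP=> /eqP => [->|->]; rewrite ?coefm_zerom valuation0.
Qed.

Lemma coef_del_term g m m' : del_term g m m' = if m' == m then 0 else g m'.
Proof.
rewrite /del_term -big_filter coef_sum_monom; last first.
  by apply: filter_uniq; exact: fset_uniq.
rewrite mem_filter in_suppm -andbA; case: (m' == m) => //=.
case: ifPn => //; rewrite negb_and !negbK.
by case/orP=> /eqP ->; rewrite ?coefm_zerom.
Qed.

Lemma monom_del_term g m : monom (g m) m + del_term g m = g.
Proof.
apply/monalgP => m'; rewrite coefmD coef_monom coef_del_term.
case: eqP => [->|_] /=; last by rewrite add0r.
by case: eqP => [->|_] /=; rewrite addr0 ?coefm_zerom.
Qed.

Lemma Trop_ind (P : Trop nu A -> Prop) : (forall u, P (pi u)) -> forall x, P x.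
Proof. exact: congr_quot_ind. Qed.

Lemma Trop_proj_bend f m : phi f = 0 -> m \in suppm (trop_poly nu f) ->
  pi (trop_poly nu f) = pi (del_term (trop_poly nu f) m).
Proof.
move=> f0 fm; apply: (congr_piP (@trop_rel _ _ nu A) _ _).2.
by apply: gen_congr_sub; exists f => //; exists m.
Qed.

(* Either [nu k <= v m] and the inequality already holds in T[M], or the
   coefficient of [trop (k m - P)] at [m] dominates [nu k] while all its other
   terms are bounded by [v], so that the bend relation at [m] applies. *)
Lemma monom_trop_le P k m v :
  phi (monom k m) = phi P -> (forall m', nu (P m') <=+ v m') ->
  pi (monom (nu k) m) <=+ pi v.
Proof.
move=> kmP Pv; have pi_mor : nmod_morphism pi.
  by split=> [|x y]; rewrite ?rmorph0 ?rmorphD.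
have [->|m0] := eqVneq m zerom.
  by rewrite monom_zerom rmorph0 /idem_le add0r.
have [kv|kv] := pselect (nu k <=+ v m).
  apply: idem_le_mor => //; apply/monalg_leP => m'; rewrite coef_monom.
  by case: eqP => [->|_] /=; rewrite ?m0 // /idem_le add0r.
pose f := monom k m + monalgC M (-1) * P.
have fE m' : f m' = monom k m m' - P m'.
  by rewrite /f coefmD coef_monalgCM mulN1r.
have f0 : phi f = 0.
  by rewrite rmorphD rmorphM /= lab_mapC kmP rmorphN1 mulN1r subrr.
have kf : nu k <=+ nu (f m).
  have : nu k <=+ nu (f m) + v m.
    rewrite -[k](subrK (P m)); apply: idem_le_trans (Defs.valD _ _ _) _.
    rewrite fE coef_monom eqxx m0 /=.
    by apply: idem_leD => //; rewrite /idem_le trop_idem.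
  (* By totality the sum equals one of its two terms, and [v m] is excluded by [kv]. *)
  by case: (trop_le_total (nu (f m)) (v m)) => H; rewrite ?H // addrC H.
have fm : m \in suppm (trop_poly nu f).
  rewrite in_suppm coef_trop_poly; apply/eqP => fm0; apply: kv.
  by move: kf; rewrite fm0 /idem_le addr0 => ->; rewrite add0r.
have -> : pi v = pi (trop_poly nu f + v).
  have -> : pi (trop_poly nu f + v) = pi (del_term (trop_poly nu f) m + v).
    by rewrite !rmorphD (Trop_proj_bend f0 fm).
  congr (pi _); apply/esym/monalg_leP => m'.
  rewrite coef_del_term coef_trop_poly.
  case: eqP => [_|/eqP m'm]; first by rewrite /idem_le add0r.
  by rewrite fE coef_monom (negPf m'm) add0r valuationN.
apply: idem_le_mor => //; apply/monalg_leP => m'.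
rewrite coefmD coef_monom coef_trop_poly.
case: eqP => [->|_] /=; last by rewrite /idem_le add0r.
by rewrite m0 /idem_le addrA kf.
Qed.

Lemma Mon_repr (x : Mon A) : exists km : K * M, x = Mon_of km.1 km.2.
Proof.
by have [k [m xE]] := Mon_monomial x; exists (k, m); apply: val_inj.
Qed.

Definition trop_mon (x : Mon A) : Trop nu A :=
  let km := projT1 (cid (Mon_repr x)) in pi (monom (nu km.1) km.2).

(** The presentation chosen in [trop_mon] does not matter: two presentations of one monomial bound
    each other by [monom_trop_le], with [P] and [v] the single term on the right. *)
Lemma trop_monE k m : trop_mon (Mon_of k m) = pi (monom (nu k) m).
Proof.
rewrite /trop_mon; case: cid => -[l n] /= /(congr1 val) /= kmln.
suff le k1 m1 k2 m2 : phi (monom k1 m1) = phi (monom k2 m2) ->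
    pi (monom (nu k1) m1) <=+ pi (monom (nu k2) m2).
  by apply: idem_le_anti; apply: le.
move=> /monom_trop_le; apply=> m'; rewrite !coef_monom.
by case: ifP => _; rewrite ?valuation0 /idem_le trop_idem.
Qed.

Lemma Mon_of1 : Mon_of 1 1%g = 1%g :> Mon A.
Proof. by apply: val_inj; rewrite /= lab_mapC rmorph1. Qed.

Lemma Mon_ofM k l m n :
  Mon_of (k * l) (m * n)%g = (Mon_of k m * Mon_of l n)%g :> Mon A.
Proof. by apply: val_inj; rewrite /= -rmorphM monomM. Qed.

Lemma Mon_ofC k : Mon_of k 1%g = Mon_scal A k.
Proof. by apply: val_inj; rewrite /= lab_mapC. Qed.

Lemma trop_mon_valuation : monomial_valuation (S := Trop nu A) nu trop_mon.
Proof.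
split=> [|x y|k|n x y c Oc yE].
- by rewrite -Mon_of1 trop_monE valuation1; exact: (rmorph1 pi).
- have [[k m] ->] := Mon_repr x; have [[l n] ->] := Mon_repr y.
  by rewrite -Mon_ofM !trop_monE Defs.valM -monomM; exact: (rmorphM pi).
- by rewrite -Mon_ofC trop_monE.
have [[k m] ykm] := Mon_repr y; rewrite ykm trop_monE.
have /boolp.choice[km xkm] i := Mon_repr (x i).
(* [P] lifts the given combination to K[M]. Since the [c i] lie in O_K, its coefficients are bounded
   by those of the sum of the tropical terms of the [x i]. *)
pose P := \sum_(i < n) monom (c i * (km i).1) (km i).2.
under eq_bigr => i _ do rewrite xkm trop_monE.
rewrite -(rmorph_sum pi); apply: (@monom_trop_le P).
  rewrite rmorph_sum -[LHS]/(val (Mon_of k m)) -ykm [LHS]yE.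
  apply: eq_bigr => i _; rewrite xkm /= -lab_mapC -rmorphM /=.
  by rewrite monomM mul1g.
move=> m'; rewrite !coefm_sum; apply: idem_le_trans (valuation_sum _ _ _) _.
elim/big_ind2: _ => [|*|i _]; [by rewrite /idem_le addr0|exact: idem_leD|].
rewrite !coef_monom; case: ifP => _; first exact: valuation_ring_le.
by rewrite valuation0 /idem_le addr0.
Qed.

End Bend.

(** * The universal property of Trop(A) *)

Section UniversalProperty.
Variables (K : fieldType) (R : realType) (nu : valuation K R).
Variables (A : labelled_algebra K) (S : algebra (tropical R)).
Local Notation M := (lab_monoid A).
Local Notation phi := (lab_map A).
Local Notation pi := (Trop_proj nu A).

Lemma alg_hom_trop_mon (f : Trop nu A -> S) :
  alg_hom f -> monomial_valuation nu (f \o @trop_mon _ _ nu A).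
Proof.
move=> [f_nmod [f1 fM] f_alg].
have [w1 wM w_scal w_lin] := trop_mon_valuation nu A.
split=> [|x y|k|n x y c Oc yE] /=.
- by rewrite w1.
- by rewrite wM fM.
- by rewrite w_scal f_alg.
have -> : \sum_(i < n) f (trop_mon nu (x i))
    = f (\sum_(i < n) trop_mon nu (x i)).
  by rewrite (big_morph f f_nmod.2 f_nmod.1).
by apply: idem_le_mor => //; exact: w_lin yE.
Qed.

Section Lift.
Variable w : Mon A -> S.
Hypothesis w_val : monomial_valuation nu w.

(** Additive in [t] by construction; multiplicativity of [w] identifies it at [t = nu k] with the
    value of [w] at [k m]. *)
Definition lift_mon (m : M) (t : tropical R) : S :=
  alg_map S t * w (Mon_of 1 m).

(** This is the form in which condition (2) gets used: the sign arises from solving a relation in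
    the kernel of [phi] for one of its terms. *)
Lemma mval_sum (r : seq M) (h : M -> K) (y : Mon A) :
  Mon_val y = - \sum_(m <- r) phi (monom (h m) m) ->
  w y <=+ \sum_(m <- r) w (Mon_of (h m) m).
Proof.
rewrite -sumrN big_tnth [X in _ -> _ <=+ X]big_tnth => yE.
apply: (mval_lin w_val (c := fun=> -1)) => [i|]; first exact: valuation_ringN1.
by rewrite yE; apply: eq_bigr => i _; rewrite rmorphN1 mulN1r.
Qed.

Lemma lift_monE k m : lift_mon m (nu k) = w (Mon_of k m).
Proof.
rewrite /lift_mon -(mval_scal w_val) -(mvalM w_val) -Mon_ofC -Mon_ofM.
by rewrite mulr1 mul1g.
Qed.

Lemma lift_mon_nmod m : nmod_morphism (lift_mon m).
Proof.
by split=> [|s t]; rewrite /lift_mon ?rmorph0 ?mul0r // rmorphD mulrDl.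
Qed.

(** In A the absorbing element becomes the scalar 0, where [mval_scal] prescribes the value. *)
Lemma lift_mon_zerom t : lift_mon zerom t = 0.
Proof.
rewrite /lift_mon; have -> : Mon_of 1 zerom = Mon_scal A 0.
  by apply: val_inj; rewrite /= monom_zerom !rmorph0.
by rewrite (mval_scal w_val) valuation0 rmorph0 mulr0.
Qed.

Definition lift_poly : monalg (tropical R) M -> S := linm lift_mon.

Lemma lift_poly_monom t m : lift_poly (monom t m) = lift_mon m t.
Proof. exact: linm_monom lift_mon_nmod lift_mon_zerom _ _. Qed.

Lemma lift_polyD u v : lift_poly (u + v) = lift_poly u + lift_poly v.
Proof. exact: linmD lift_mon_nmod _ _. Qed.

Lemma lift_poly0 : lift_poly 0 = 0.
Proof. exact: linm0. Qed.

Lemma lift_poly1 : lift_poly 1 = 1.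
Proof.
by rewrite lift_poly_monom /lift_mon rmorph1 mul1r Mon_of1 (mval1 w_val).
Qed.

Lemma lift_polyM u v : lift_poly (u * v) = lift_poly u * lift_poly v.
Proof.
elim/monalg_ind: u => [|u1 u2 IH1 IH2|s a].
- by rewrite mul0r lift_poly0 mul0r.
- by rewrite mulrDl !lift_polyD IH1 IH2 mulrDl.
elim/monalg_ind: v => [|v1 v2 IH1 IH2|t b].
- by rewrite mulr0 lift_poly0 mulr0.
- by rewrite mulrDr !lift_polyD IH1 IH2 mulrDr.
rewrite monomM !lift_poly_monom /lift_mon rmorphM mulrACA -(mvalM w_val).
by rewrite -Mon_ofM mulr1.
Qed.

(** In A the [m]-term of [f] is minus the sum of the other terms, so its value lies below the sum of
    theirs and is absorbed by it. *)
Lemma lift_poly_bend u v : trop_rel nu u v -> lift_poly u = lift_poly v.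
Proof.
move=> [f f0 [m fm [-> ->]]].
set g := trop_poly nu f; pose r := [seq m' <- suppm g | m' != m].
have r_uniq : uniq r by apply: filter_uniq; exact: fset_uniq.
rewrite -{1}(monom_del_term g m) lift_polyD lift_poly_monom.
rewrite /g coef_trop_poly lift_monE.
have -> : lift_poly (del_term g m) = \sum_(m' <- r) w (Mon_of (f m') m').
  rewrite /del_term -big_filter (big_morph lift_poly lift_polyD lift_poly0).
  by apply: eq_bigr => m' _; rewrite lift_poly_monom coef_trop_poly lift_monE.
(* The goal has the shape [a + b = b], which is [a <=+ b] by definition. *)
apply: mval_sum => /=; apply/eqP; rewrite -addr_eq0 -rmorph_sum -rmorphD -f0.
apply/eqP; congr (phi _); apply/monalgP => m'.
rewrite coefmD coef_monom coef_sum_monom // mem_filter in_suppm coef_trop_poly.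
have [->|_] := eqVneq m' zerom; first by rewrite !andbF addr0 coefm_zerom.
rewrite !andbT; have [->|_] /= := eqVneq m' m; first by rewrite addr0.
(* Outside the support of [trop_poly nu f] the coefficient of [f] vanishes too, as [nu] is -oo only
   at 0. *)
rewrite add0r; case: ifPn => //; rewrite negbK => /eqP.
by move/(Defs.val_eq0 nu) ->.
Qed.

Lemma lift_poly_pi u v : pi u = pi v -> lift_poly u = lift_poly v.
Proof.
(* The generated congruence is contained in every congruence with the bend relations, in particular
   in the kernel congruence of [lift_poly]. *)
move=> /congr_piP uv; apply: uv lift_poly_bend.
split=> [//|a b ->//|a b c -> ->//|a b c d|a b c d].
  by rewrite !lift_polyD => -> ->.
by rewrite !lift_polyM => -> ->.
Qed.

Definition Trop_lift (x : Trop nu A) : S :=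
  lift_poly (repr (x : Trop_semiring nu A)).

Lemma Trop_lift_pi u : Trop_lift (pi u) = lift_poly u.
Proof. by apply: lift_poly_pi; exact: congr_pi_repr. Qed.

Lemma Trop_lift_hom : alg_hom Trop_lift.
Proof.
split=> [||t].
- split=> [|x y]; first by rewrite -(rmorph0 pi) Trop_lift_pi lift_poly0.
  elim/Trop_ind: x => u; elim/Trop_ind: y => v.
  by rewrite -(rmorphD pi) !Trop_lift_pi lift_polyD.
- split=> [|x y]; first by rewrite -(rmorph1 pi) Trop_lift_pi lift_poly1.
  elim/Trop_ind: x => u; elim/Trop_ind: y => v.
  by rewrite -(rmorphM pi) !Trop_lift_pi lift_polyM.
by rewrite Trop_lift_pi lift_poly_monom /lift_mon Mon_of1 (mval1 w_val) mulr1.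
Qed.

Lemma Trop_lift_monom k m : Trop_lift (pi (monom (nu k) m)) = w (Mon_of k m).
Proof. by rewrite Trop_lift_pi lift_poly_monom lift_monE. Qed.

End Lift.

Hypothesis nu_surj : forall t, exists k, nu k = t.

(** Surjectivity of [nu] turns every term of a tropical polynomial into some [nu k] times [m], and
    such terms generate additively. *)
Lemma alg_hom_eq (f g : Trop nu A -> S) : alg_hom f -> alg_hom g ->
  (forall k m, f (pi (monom (nu k) m)) = g (pi (monom (nu k) m))) -> f = g.
Proof.
move=> [[f0 fD] _ _] [[g0 gD] _ _] fg; apply/funext => x.
elim/Trop_ind: x => u.
elim/monalg_ind: u => [|u v IHu IHv|t m].
- by rewrite rmorph0 f0 g0.
- by rewrite rmorphD fD gD IHu IHv.
by have [k <-] := nu_surj t; exact: fg.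
Qed.

Lemma trop_mon_bij : set_bij [set f : Trop nu A -> S | alg_hom f]
  [set w : Mon A -> S | monomial_valuation nu w]
  (fun f => f \o @trop_mon _ _ nu A).
Proof.
split=> [f fhom|f g|w wval].
- exact: alg_hom_trop_mon.
- rewrite !inE /= => fhom ghom fg; apply: alg_hom_eq => // k m.
  by rewrite -trop_monE; exact: (congr1 (@^~ (Mon_of k m)) fg).
exists (Trop_lift w); first exact: Trop_lift_hom.
apply/funext => x; have [[k m] ->] := Mon_repr x.
by rewrite /= trop_monE Trop_lift_monom.
Qed.

End UniversalProperty.

(** * The isomorphism with finitely generated monomial submodules *)

Section FgMonIso.
Variables (K : fieldType) (R : realType) (nu : valuation K R).
Hypothesis nu_surj : forall t, exists k, nu k = t.
Variable A : labelled_algebra K.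
Local Notation M := (lab_monoid A).
Local Notation phi := (lab_map A).
Local Notation pi := (Trop_proj nu A).
Local Notation S := (Sfgmon A nu_surj).

Lemma fgmon_leP (N N' : fgmon nu A) :
  N <=+ N' <-> fgmon_set N `<=` fgmon_set N'.
Proof.
split=> [<- x Nx|NN']; first by apply: sub_OK_span; left.
by apply: val_inj; rewrite /= ((setUidPr _ _).2 NN') fgmonK.
Qed.

Lemma fgmon_submod (N : fgmon nu A) : OK_submodule nu N.
Proof. by rewrite -fgmonK; exact: OK_span_submod. Qed.

Definition mon_span (x : Mon A) : S :=
  to_fgmon (is_fgmon_monomial nu (Mon_monomial x)).

Lemma mon_span_valuation : monomial_valuation nu mon_span.
Proof.
split=> [|x y|k|n x y c Oc yE].
- by apply: val_inj.
- apply: val_inj; rewrite /= OK_spanMl OK_spanMr; congr OK_span.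
  apply/seteqP; split=> [_ ->|_ [_ -> [_ -> <-]]] //.
  by exists (Mon_val x) => //; exists (Mon_val y).
- by rewrite [RHS]fgmon_mapE; apply: val_inj.
set N := \sum_(i < n) _; have N_sub := fgmon_submod N.
apply/fgmon_leP; apply: OK_span_min => // _ ->; rewrite yE.
have xN i : fgmon_set N (Mon_val (x i)).
  (* By idempotency a sum lies above each of its terms. *)
  have /fgmon_leP : mon_span (x i) <=+ N.
    by rewrite /idem_le /N (bigD1 i) //= addrA (alg_idem (mon_span (x i))).
  by apply; exact: sub_OK_span.
elim/big_ind: _ => [|a b|i _].
- exact: submod0 N_sub.
- exact: submodD N_sub _ _.
exact: submodZ N_sub _ _ (Oc i) (xN i).
Qed.

Local Notation F := (Trop_lift (nu := nu) mon_span).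

(** An upper bound for the submodule attached to [pi u]: membership in it supplies the lift [P] that
    [monom_trop_le] asks for. *)
Definition trop_ball (u : monalg (tropical R) M) : set A :=
  [set phi P | P in [set P : monalg K M | forall m, nu (P m) <=+ u m]].

Lemma trop_ball_submod u : OK_submodule nu (trop_ball u).
Proof.
split=> [|_ _ [P Pu <-] [Q Qu <-]|c _ Oc [P Pu <-]].
- exists 0; last exact: rmorph0.
  by move=> m; rewrite coefm_eq0 valuation0 /idem_le add0r.
- exists (P + Q); last exact: rmorphD.
  move=> m; rewrite coefmD; apply: idem_le_trans (Defs.valD _ _ _) _.
  exact: trop_leD2.
exists (monalgC M c * P); last by rewrite rmorphM /= lab_mapC.
move=> m; rewrite coef_monalgCM.
by apply: idem_le_trans (Pu m); exact: valuation_ring_le.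
Qed.

Lemma Trop_lift_span_sub u : fgmon_set (F (pi u)) `<=` trop_ball u.
Proof.
have [[F0 FD] _ _] := Trop_lift_hom mon_span_valuation.
elim/monalg_ind: u => [|u v IHu IHv|t m].
- by rewrite rmorph0 F0; apply: OK_span_min => //; exact: trop_ball_submod.
- rewrite rmorphD FD; apply: OK_span_min; first exact: trop_ball_submod.
  move=> x [/IHu|/IHv] [P Pu <-];
    exists P => // m; rewrite coefmD; apply: idem_le_trans (Pu m) _.
    by rewrite /idem_le addrA trop_idem.
  by rewrite /idem_le addrCA trop_idem.
have [k <-] := nu_surj t; rewrite Trop_lift_monom; last first.
  exact: mon_span_valuation.
apply: OK_span_min; first exact: trop_ball_submod.
move=> _ ->; exists (monom k m) => // m'.
by rewrite !coef_monom; case: ifP => _; rewrite ?valuation0 /idem_le trop_idem.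
Qed.

(** Sums are least upper bounds, so a single term [nu k] times [m] suffices. Its generator
    [phi (k m)] lies in the ball of [v], and [monom_trop_le] applies to the resulting [P]. *)
Lemma Trop_lift_le u v :
  fgmon_set (F (pi u)) `<=` fgmon_set (F (pi v)) -> pi u <=+ pi v.
Proof.
have [[F0 FD] _ _] := Trop_lift_hom mon_span_valuation.
elim/monalg_ind: u => [|u1 u2 IH1 IH2|t m] uv.
- by rewrite rmorph0 /idem_le add0r.
- have u1v : pi u1 <=+ pi v.
    apply: IH1 => x ux; apply: uv; rewrite rmorphD FD.
    by apply: sub_OK_span; left.
  have u2v : pi u2 <=+ pi v.
    apply: IH2 => x ux; apply: uv; rewrite rmorphD FD.
    by apply: sub_OK_span; right.
  by rewrite rmorphD /idem_le -addrA u2v u1v.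
have [k kt] := nu_surj t.
have /uv /Trop_lift_span_sub [P Pv kmP] :
    fgmon_set (F (pi (monom t m))) (phi (monom k m)).
  rewrite -kt Trop_lift_monom; last exact: mon_span_valuation.
  exact: sub_OK_span.
by rewrite -kt; exact: (monom_trop_le (esym kmP)).
Qed.

Lemma Trop_lift_span_bij : bijective F.
Proof.
have [[F0 FD] _ _] := Trop_lift_hom mon_span_valuation.
rewrite -setTT_bijective; split=> // [x y _ _|N _].
  (* Injectivity is order reflection in both directions with antisymmetry. *)
  elim/Trop_ind: x => u; elim/Trop_ind: y => v Fuv.
  by apply: idem_le_anti; apply: Trop_lift_le; rewrite Fuv.
(* Surjectivity goes by induction on a list of generators: each generator [phi (k m)] contributes
   the summand [nu k] times [m] to the preimage. *)
have [X [/finite_seqP[s ->] sMon] NE] := fgmon_is N.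
suff [x Fx] : exists x, fgmon_set (F x) = OK_span nu [set` s].
  by exists x => //; apply: val_inj; rewrite /= Fx NE.
elim: s sMon {NE} => [|y s IHs] sMon.
  by exists 0; rewrite F0 set_nil.
have [|x Fx] := IHs.
  by move=> z /= zs; apply: sMon; rewrite /= inE zs orbT.
have [|k [m yE]] := sMon y; first by rewrite /= inE eqxx.
exists (pi (monom (nu k) m) + x); rewrite FD Trop_lift_monom; last first.
  exact: mon_span_valuation.
rewrite /= Fx OK_spanUl OK_spanUr -yE; congr OK_span.
apply/seteqP; split=> [z [->|zs]|z] /=; rewrite inE ?eqxx //.
  by rewrite zs orbT.
by case/orP=> [/eqP|]; [left|right].
Qed.

End FgMonIso.

Theorem theoremD (R : realType) (K : fieldType) (nu : valuation K R)
    (nu_surj : forall t : tropical R, exists k : K, nu k = t)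
    (A : labelled_algebra K) :
  (exists Phi : forall S : algebra (tropical R),
                  (Trop nu A -> S) -> (Mon A -> S),
    [/\ forall S : algebra (tropical R),
          set_bij [set f : Trop nu A -> S | alg_hom f]
                  [set w : Mon A -> S | monomial_valuation nu w] (Phi S),
        forall (S S' : algebra (tropical R)) (h : S -> S') (f : Trop nu A -> S),
          alg_hom h -> alg_hom f -> Phi S' (h \o f) = h \o Phi S f
      & forall (S : algebra (tropical R)) (f : Trop nu A -> S)
               (k : K) (m : lab_monoid A),
          alg_hom f ->
          Phi S f (Mon_of k m) = f (Trop_proj nu A (monom (nu k) m))])
  /\ (exists F : Trop nu A -> Sfgmon A nu_surj, alg_hom F /\ bijective F).
Proof.
split; last first.
  exists (Trop_lift (mon_span nu_surj (A := A))).
  by split; [apply: Trop_lift_hom; exact: mon_span_valuation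
            |exact: Trop_lift_span_bij].
(* The correspondence is precomposition with the universal valuation, so naturality is associativity
   of composition. *)
exists (fun S f => f \o @trop_mon _ _ nu A).
split=> [S|//|S f k m _] /=; first exact: trop_mon_bij.
by rewrite trop_monE.
Qed.
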